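(* Let $p\in[1,2)$ be a real number. Then every Borel probability measure on $\mathbb{T}$ is uniquely determined by its $p$-Wasserstein potential: if $\mu$ and $\nu$ are Borel probability measures on $\mathbb{T}$ such that $\mathcal{T}_\mu^{(p)}(z)=\mathcal{T}_\nu^{(p)}(z)$ for all $z\in\mathbb{T}$, then $\mu=\nu$.
   Context: $\mathbb{T}=\{z\in\mathbb{C} : |z|=1\}$ is equipped with the distance $r(z,\omega)=\left|\tfrac12(z-\omega)\right|$. For a Borel probability measure $\mu$ on $\mathbb{T}$, its $p$-Wasserstein potential is the function $\mathcal{T}_\mu^{(p)}\colon\mathbb{T}\to\mathbb{R}$ given by $$\mathcal{T}_\mu^{(p)}(z)=\int_{\mathbb{T}}\left|\tfrac12(z-\omega)\right|^p\,\mathrm{d}\mu(\omega),$$ which equals the $p$-th power of the $p$-Wasserstein distance between $\mu$ and the Dirac measure $\delta_z$. *)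

(* Defs.v *)
From HB Require Import structures.
From mathcomp Require Import all_boot all_order all_algebra complex.
From mathcomp Require Import all_classical all_reals all_analysis.

Set Implicit Arguments.
Unset Strict Implicit.
Unset Printing Implicit Defensive.

Import Order.TTheory GRing.Theory Num.Theory.
Import numFieldNormedType.Exports.
Import ComplexField.Normc.

Local Open Scope classical_set_scope.
Local Open Scope ring_scope.

(* The modulus is [normc], which is [R]-valued, whereas [`|z|] lies in [R[i]].
   The alias [R[i]^o] gives access to the usual topology of the complex
   numbers. *)
Definition unit_circle (R : realType) : set R[i]^o := [set z | normc z = 1].
Arguments unit_circle : clear implicits.

Definition circle (R : realType) : Type := set_type (unit_circle R).

(* The subspace topology inherited from the complex numbers, which is also the
   topology of the distance [chord_dist] below. *)
HB.instance Definition _ (R : realType) :=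
  Topological.on (circle R).

Lemma unit_circle1 (R : realType) : (1 : R[i]^o) \in unit_circle R.
Proof. by rewrite inE; exact: normc1. Qed.

(* Measurable types are pointed. *)
HB.instance Definition _ (R : realType) :=
  isPointed.Build (circle R) (SigSub (unit_circle1 R) : circle R).

Definition borel_circle (R : realType) :=
  g_sigma_algebraType (@open (circle R)).

Definition chord_dist (R : realType) (z w : circle R) : R :=
  normc (2%:R^-1 * ((set_val z : R[i]) - (set_val w : R[i]))).

Definition wasserstein_potential (R : realType) (p : R)
    (mu : probability (borel_circle R) R) (z : circle R) : R :=
  \int[mu]_(w in [set: borel_circle R]) (chord_dist z w `^ p).

(* Main.v *)
Require Import Defs.
From mathcomp Require Import all_boot all_order all_algebra complex.
From mathcomp Require Import all_classical all_reals all_analysis.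
From mathcomp Require Import measurable_realfun ring lra.

Import Order.TTheory GRing.Theory Num.Theory.

Local Open Scope classical_set_scope.
Local Open Scope ring_scope.

Import numFieldNormedType.Exports.

(** Write a point of the circle as x + iy and put s = p / 2, so that 0 < s < 1.
Then chord_dist z w `^ p = (1 - v z w) `^ s, where
v z w = (1 + x x' + y y') / 2 lies in [0, 1] and is a sum of products
e_i(z) e_i(w) of the three features 1, x, y divided by sqrt 2
([chord_dist_powR], [circle_kernel01]).

The binomial series (1 - t) `^ s = 1 - sum_(k >= 1) c_k t ^+ k has c_k > 0 for
every k >= 1 because 0 < s < 1, and its partial sums stay in [0, 1] and converge
on all of [0, 1] ([binom_coef_lt0], [cvg_binom_poly]). Integrate the kernel
twice against the signed measure sigma = mu - nu. The inner integral is the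
difference of the two potentials, hence 0. On the other hand v ^+ k is the sum
over all words of length k in the features of word(z) word(w), so the double
integral is also minus the sum over k of c_k times the squared integrals of the
words of length k against sigma. All terms have the same sign, so each of these
integrals vanishes: mu and nu have the same moments ([eq_moments]).

It remains to see that moments determine the measure. The polynomials in the
features form an algebra A of bounded functions on which the two integrals
agree. They still agree on bounded pointwise limits of sequences from A; the
binomial series with s = 1/2 shows that |f| is such a limit for f in A. Hence mu
and nu agree on the pi-system of the sets where such a limit is nonzero, which
contains all sets where some f in A is positive ([probability_eq_algebra]). Open
discs of the plane cut the circle in sets of that form, and countably many of
them generate the Borel sets ([borel_circle_gen]). *)

(** * The binomial series of (1 - t) `^ s *)

(** The coefficient of t ^+ k in (1 - t) `^ s, sign included: it is
(- 1) ^+ k times the generalized binomial coefficient s over k. *)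
Fixpoint binom_coef {R : fieldType} (s : R) (k : nat) : R :=
  if k is j.+1 then binom_coef s j * (j%:R - s) / j.+1%:R else 1.

Arguments binom_coef {R} s k : simpl never.

Definition binom_poly {R : fieldType} (s : R) (n : nat) : {poly R} :=
  \poly_(k < n) binom_coef s k.

Lemma binom_polyS {R : fieldType} (s : R) (n : nat) :
  binom_poly s n.+1 = binom_poly s n + binom_coef s n *: 'X^n.
Proof. by rewrite /binom_poly !poly_def big_ord_recr. Qed.

Lemma binom_coefS {R : numFieldType} (s : R) (n : nat) :
  n.+1%:R * binom_coef s n.+1 = binom_coef s n * (n%:R - s).
Proof. by rewrite mulrC [binom_coef s n.+1]/(_ * _ / _) divfK// pnatr_eq0. Qed.

(** The function (1 - t) `^ s solves (1 - t) y' + s y = 0; a truncation of its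
series solves the same equation up to a single monomial, since all the other
coefficients cancel by [binom_coefS]. *)
Lemma binom_poly_ode {R : numFieldType} (s : R) (n : nat) :
  (1 - 'X) * (binom_poly s n.+1)^`() + s *: binom_poly s n.+1 =
  (- (n.+1%:R * binom_coef s n.+1)) *: 'X^n.
Proof.
elim: n => [|n IH].
  rewrite binom_polyS /binom_poly poly_def big_ord0 add0r !expr0 binom_coefS /=.
  by rewrite derivZ derivC scaler0 mulr0 add0r scale1r sub0r mul1r opprK.
rewrite binom_polyS derivD scalerDr mulrDr addrACA {}IH.
rewrite [in RHS]binom_coefS derivZ derivXn -pred_Sn exprS -['X^n *+ _]scaler_nat.
rewrite -!mul_polyC.
move: (binom_coef s n.+1) (n.+1%:R : R) ('X^n : {poly R}) => a c X.
rewrite !(polyCN, polyCM, polyCB).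
ring.
Qed.

(** Bounds the defect in [binom_poly_ode] independently of n: passing from n to
n + 1 multiplies it by 1 - s / n.+1. *)
Lemma binom_coef_bound {R : numFieldType} (s : R) (n : nat) :
  0 <= s <= 1 -> 0 <= - (n.+1%:R * binom_coef s n.+1) <= s.
Proof.
move=> /andP[s0 s1]; elim: n => [|n /andP[IH0 IH1]].
  by rewrite binom_coefS /= mul1r sub0r opprK s0 lexx.
have n0 : (0 : R) < n.+1%:R by rewrite ltr0n.
have n1 : 0 <= n.+1%:R - s by rewrite subr_ge0 (le_trans s1)// ler1n.
have E : - (n.+2%:R * binom_coef s n.+2) =
         - (n.+1%:R * binom_coef s n.+1) * ((n.+1%:R - s) / n.+1%:R).
  by rewrite binom_coefS; field; rewrite lt0r_neq0.
rewrite E mulr_ge0 ?divr_ge0 ?(ltW n0)//= (le_trans _ IH1)// ler_piMr//.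
by rewrite ler_pdivrMr// mul1r gerBl.
Qed.

Lemma binom_coef_le0 {R : numFieldType} (s : R) (n : nat) :
  0 <= s <= 1 -> binom_coef s n.+1 <= 0.
Proof.
move=> /(binom_coef_bound s n)/andP[+ _].
by rewrite -mulrN pmulr_rge0 ?ltr0n// oppr_ge0.
Qed.

Lemma binom_coef_lt0 {R : numFieldType} (s : R) (n : nat) :
  0 < s < 1 -> binom_coef s n.+1 < 0.
Proof.
move=> /andP[s0 s1]; elim: n => [|n IH].
  have := binom_coefS s 0; rewrite !mul1r sub0r => ->; by rewrite oppr_lt0.
rewrite -(pmulr_rlt0 _ (ltr0Sn R n.+1)) binom_coefS nmulr_rlt0//.
by rewrite subr_gt0 (lt_le_trans s1)// ler1n.
Qed.

Lemma binom_poly_le {R : numFieldType} (s : R) (n : nat) (x y : R) :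
  0 <= s <= 1 -> 0 <= x -> x <= y ->
  (binom_poly s n).[y] <= (binom_poly s n).[x].
Proof.
move=> s01 x0 xy; rewrite /binom_poly !horner_poly; apply: ler_sum => -[[|i] ? _].
  by rewrite !expr0.
by apply: ler_wnM2l; [exact: binom_coef_le0|rewrite ler_pXn2r// nnegrE (le_trans x0)].
Qed.

Lemma binom_poly_le1 {R : numFieldType} (s : R) (n : nat) (x : R) :
  0 <= s <= 1 -> 0 <= x -> (binom_poly s n).[x] <= 1.
Proof.
move=> s01 x0; apply: le_trans (binom_poly_le s n 0 x s01 (lexx _) x0) _.
by rewrite horner_coef0 coef_poly; case: ifP.
Qed.

(** By [binom_poly_ode] the quotient D of the partial sum by (1 - t) `^ s has
derivative c t ^+ n (1 - t) `^ (- s - 1) with 0 <= c <= s, and D 0 = 1; the mean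
value theorem on [0, v] gives both bounds. *)
Lemma binom_poly_powR {R : realType} (s : R) (n : nat) (v : R) :
  0 <= s <= 1 -> 0 <= v -> v < 1 ->
  1 <= (binom_poly s n.+1).[v] * (1 - v) `^ (- s) <=
  1 + (1 - v) `^ (- s - 1) * v ^+ n.
Proof.
move=> s01 v0 v1; have /andP[s0 s1] := s01.
pose D t : R := (binom_poly s n.+1).[t] * (1 - t) `^ (- s).
pose c := - (n.+1%:R * binom_coef s n.+1).
pose dD t : R := c * t ^+ n * (1 - t) `^ (- s - 1).
have dDP (t : R) : t < 1 -> is_derive t 1 D (dD t).
  move=> t1; have t10 : 0 < 1 - t by rewrite subr_gt0.
  have dp : is_derive t (1 : R) (fun x => (1 - x) `^ (- s)) (s * (1 - t) `^ (- s - 1)).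
    apply: (@trigger_derive _ _ _ ((- s * (1 - t) `^ (- s - 1)) * (0 - 1))).
      apply: (@is_derive1_comp _ (fun x : R => x `^ (- s)) (fun x : R => 1 - x)).
      exact: is_derive1_powR.
    by ring.
  apply: trigger_derive.
  have : ((1 - 'X) * (binom_poly s n.+1)^`() + s *: binom_poly s n.+1).[t] =
         (c *: 'X^n).[t] by rewrite binom_poly_ode.
  rewrite !hornerE /dD => <-.
  rewrite (_ : (1 - t) `^ (- s) = (1 - t) * (1 - t) `^ (- s - 1)).
    by rewrite /GRing.scale/=; ring.
  rewrite -{2}(powRr1 (ltW t10)) -powRD; first by congr (_ `^ _); ring.
  by rewrite (gt_eqF t10) implybT.
have D0 : D 0 = 1.
  rewrite /D subr0 powR1 mulr1 horner_coef0 coef_poly //.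
have [t tv] : exists2 t, t \in `[0, v] & D v - D 0 = dD t * (v - 0).
  apply: MVT_segment => //.
    by move=> x; rewrite in_itv/= => /andP[x0 xv]; apply: dDP; exact: lt_trans v1.
  apply: derivable_within_continuous => x; rewrite in_itv/= => /andP[x0 xv].
  by apply: (@ex_derive _ _ _ _ _ _ (dD x)); apply: dDP; exact: le_lt_trans v1.
rewrite D0 subr0 => /eqP; rewrite subr_eq addrC => /eqP DvE.
rewrite -/(D v) DvE.
move: tv; rewrite in_itv/= => /andP[t0 tv].
have /andP[c0 cs] := binom_coef_bound s n s01; rewrite -/c in c0 cs.
have dt0 : 0 <= dD t by rewrite /dD !mulr_ge0 ?powR_ge0 ?exprn_ge0.
rewrite lerDl mulr_ge0//= lerD2l (le_trans (ler_piMr dt0 (ltW v1)))//.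
rewrite /dD mulrC ler_pM ?powR_ge0 ?mulr_ge0 ?exprn_ge0//.
  rewrite -opprD !powRN lef_pV2 ?posrE ?powR_gt0 ?subr_gt0//; last exact: le_lt_trans v1.
  rewrite ge0_ler_powR ?nnegrE ?subr_ge0 ?addr_ge0 ?lerD2l ?lerN2 ?(ltW v1)//.
  exact: le_trans tv (ltW v1).
rewrite (@le_trans _ _ (t ^+ n))//; first by rewrite ler_piMl ?exprn_ge0// (le_trans cs).
by rewrite lerXn2r ?nnegrE.
Qed.

Lemma binom_poly_lower {R : realType} (s : R) (n : nat) (v : R) :
  0 <= s <= 1 -> 0 <= v -> v < 1 -> (1 - v) `^ s <= (binom_poly s n.+1).[v].
Proof.
move=> s01 v0 v1.
have /andP[+ _] := binom_poly_powR s n v s01 v0 v1.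
by rewrite powRN ler_pdivlMr ?mul1r ?powR_gt0 ?subr_gt0.
Qed.

Lemma cvg_binom_poly_lt1 {R : realType} (s : R) (v : R) :
  0 <= s <= 1 -> 0 <= v -> v < 1 ->
  (binom_poly s n).[v] @[n --> \oo] --> (1 - v) `^ s.
Proof.
move=> s01 v0 v1; rewrite -(cvg_shiftS (fun n => (binom_poly s n).[v])) /=.
pose C := (1 - v) `^ (- s - 1) * (1 - v) `^ s.
apply: (@squeeze_cvgr _ _ _ _ (fun=> (1 - v) `^ s) (fun n => (1 - v) `^ s + C * v ^+ n)).
- near=> n; rewrite binom_poly_lower//=.
  have /andP[_] := binom_poly_powR s n v s01 v0 v1.
  rewrite powRN ler_pdivrMr ?mul1r ?powR_gt0 ?subr_gt0// => h; apply: (le_trans h).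
  by rewrite mulrDl mul1r mulrAC.
- exact: cvg_cst.
- rewrite -[X in _ --> X]addr0 -(mulr0 C); apply: cvgD; first exact: cvg_cst.
  by apply: cvgM; [exact: cvg_cst|apply: cvg_expr; rewrite ger0_norm].
Unshelve. all: by end_near. Qed.

(** Partial sums decrease in t, so t = 1 is the worst case; it is reached as the
limit of the values at t < 1, where the sum dominates (1 - t) `^ s. *)
Lemma binom_poly_ge0 {R : realType} (s : R) (n : nat) (v : R) :
  0 <= s <= 1 -> 0 <= v <= 1 -> 0 <= (binom_poly s n).[v].
Proof.
move=> s01 /andP[v0 v1]; case: n => [|n].
  by rewrite /binom_poly poly_def big_ord0 horner0.
apply: le_trans (binom_poly_le s n.+1 v 1 s01 v0 v1).
have c := @continuous_horner R (binom_poly s n.+1) 1.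
have c1 : (binom_poly s n.+1).[x] @[x --> 1^'-] --> (binom_poly s n.+1).[1].
  exact: cvg_at_left_filter c.
rewrite -(cvg_lim (@Rhausdorff R) c1).
apply: limr_ge; first by apply/cvg_ex; eexists; exact: c1.
near=> x; rewrite (le_trans (powR_ge0 (1 - x) s))//.
apply: binom_poly_lower => //.
near: x; apply: nbhs_left_ge; exact: ltr01.
Unshelve. all: by end_near. Qed.

(** The endpoint v = 1, where the ratio of two consecutive terms no longer stays
away from 1, follows from monotonicity: the partial sum at 1 is nonnegative and at
most its value at any r < 1, which tends to (1 - r) `^ s, and this is small for
r close to 1. *)
Lemma cvg_binom_poly {R : realType} (s v : R) :
  0 < s <= 1 -> 0 <= v <= 1 ->
  (binom_poly s n).[v] @[n --> \oo] --> (1 - v) `^ s.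
Proof.
move=> /andP[s0 s1] /andP[v0 v1]; have s01 : 0 <= s <= 1 by rewrite ltW.
move: v1; rewrite le_eqVlt => /predU1P[->|v1]; last exact: cvg_binom_poly_lt1.
rewrite subrr powR0 ?lt0r_neq0//.
apply/cvgrPdist_le => /= e e0.
(* r = 1 - t with t `^ s <= e / 2 *)
pose t := Num.min 1 ((e / 2) `^ s^-1).
have e2 : 0 < e / 2 by rewrite divr_gt0.
have t0 : 0 < t by rewrite lt_min ltr01 powR_gt0.
have t1 : t <= 1 by rewrite ge_min lexx.
have ts : t `^ s <= e / 2.
  rewrite (_ : e / 2 = ((e / 2) `^ s^-1) `^ s); last first.
    by rewrite -powRrM mulVf ?lt0r_neq0// powRr1// ltW.
  by rewrite ge0_ler_powR ?nnegrE ?powR_ge0 ?(ltW t0) ?(ltW s0)// ge_min lexx orbT.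
have r0 : 0 <= 1 - t by rewrite subr_ge0.
have r1 : 1 - t < 1 by rewrite ltrBlDr ltrDl.
have /cvgrPdist_le/(_ _ e2) := cvg_binom_poly_lt1 s (1 - t) s01 r0 r1.
apply: filterS => n; rewrite subKr ler_distlC => /andP[_ h].
rewrite sub0r normrN ger0_norm ?binom_poly_ge0 ?ler01 ?lexx//.
apply: le_trans (binom_poly_le s n (1 - t) 1 s01 r0 (ltW r1)) _.
by rewrite (le_trans h)// (le_trans (lerD ts (lexx _)))// -splitr.
Qed.

(** * Bounded measurable functions *)

Lemma cvgr_norm_le {R : realType} (u : nat -> R) (l M : R) :
  u n @[n --> \oo] --> l -> (forall n, `|u n| <= M) -> `|l| <= M.
Proof.
move=> ul uM; have uN : `|u n| @[n --> \oo] --> `|l| by apply: cvg_norm.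
rewrite -(cvg_lim (@Rhausdorff R) uN); apply: limr_le; last by near=> n.
by apply/cvg_ex; eexists; exact: uN.
Unshelve. all: by end_near. Qed.

Definition bounded_measurable {d} {X : measurableType d} {R : realType} :
    set (X -> R) :=
  [set f : X -> R | measurable_fun setT f /\ exists M : R, forall x, `|f x| <= M].

Section Integration.
Context {d : measure_display} {X : measurableType d} {R : realType}.
Implicit Types (f g : X -> R) (mu nu : probability X R).

Lemma bounded_measurable_cst (c : R) : bounded_measurable (cst c : X -> R).
Proof. by split; [exact: measurable_cst|exists `|c|]. Qed.

Lemma bounded_measurableD {f g} : bounded_measurable f -> bounded_measurable g ->
  bounded_measurable (f \+ g).
Proof.
move=> [mf [M fM]] [mg [N gN]]; split; first exact: measurable_funD.
by exists (M + N) => x; rewrite (le_trans (ler_normD _ _))// lerD.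
Qed.

Lemma bounded_measurableM {f g} : bounded_measurable f -> bounded_measurable g ->
  bounded_measurable (f \* g).
Proof.
move=> [mf [M fM]] [mg [N gN]]; split; first exact: measurable_funM.
by exists (M * N) => x; rewrite normrM ler_pM.
Qed.

Lemma bounded_measurable_sum {I : Type} (r : seq I) (F : I -> X -> R) :
  (forall i, bounded_measurable (F i)) ->
  bounded_measurable (fun x => \sum_(i <- r) F i x).
Proof.
move=> bF; elim: r => [|i r IH].
  under eq_fun do rewrite big_nil; exact: bounded_measurable_cst.
under eq_fun do rewrite big_cons; exact: bounded_measurableD.
Qed.

Lemma bounded_measurable_prod {I : Type} (r : seq I) (F : I -> X -> R) :
  (forall i, bounded_measurable (F i)) ->
  bounded_measurable (fun x => \prod_(i <- r) F i x).
Proof.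
move=> bF; elim: r => [|i r IH].
  under eq_fun do rewrite big_nil; exact: bounded_measurable_cst.
under eq_fun do rewrite big_cons; exact: bounded_measurableM.
Qed.

Lemma bounded_measurable_integrable mu {f} :
  bounded_measurable f -> mu.-integrable setT (EFin \o f).
Proof.
move=> [mf [M fM]]; apply: measurable_bounded_integrable => //.
  exact: (le_lt_trans (probability_le1 mu measurableT) (ltry 1)).
exists M; split; first exact: num_real.
by move=> N MN x _ /=; rewrite (le_trans (fM x))// ltW.
Qed.

Lemma Rintegral_lincomb mu {I : Type} (r : seq I) (c : I -> R) (F : I -> X -> R) :
  (forall i, bounded_measurable (F i)) ->
  \int[mu]_x (\sum_(i <- r) c i * F i x) = \sum_(i <- r) c i * \int[mu]_x F i x.
Proof.
move=> bF; have bcF i : bounded_measurable (fun x => c i * F i x).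
  exact: bounded_measurableM (bounded_measurable_cst (c i)) (bF i).
elim: r => [|i r IH].
  by under eq_Rintegral do rewrite big_nil; rewrite Rintegral_cst// mul0r big_nil.
under eq_Rintegral do rewrite big_cons.
rewrite RintegralD//; last 2 first.
- exact: bounded_measurable_integrable.
- by apply: bounded_measurable_integrable; exact: bounded_measurable_sum.
by rewrite IH big_cons RintegralZl//; exact: bounded_measurable_integrable.
Qed.

Lemma bounded_convergence mu (u : nat -> X -> R) f (M : R) :
  (forall n, measurable_fun setT (u n)) -> (forall n x, `|u n x| <= M) ->
  (forall x, u n x @[n --> \oo] --> f x) ->
  \int[mu]_x u n x @[n --> \oo] --> \int[mu]_x f x.
Proof.
move=> mu_ uM uf.
have mf : measurable_fun setT f by apply: measurable_fun_cvg => // x _; exact: uf.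
have fM x : `|f x| <= M by exact: cvgr_norm_le (uf x) (uM^~ x).
have bf : bounded_measurable f by split => //; exists M.
have iM : mu.-integrable setT (EFin \o cst M).
  exact/bounded_measurable_integrable/bounded_measurable_cst.
have [|||||_ _] := @dominated_convergence _ X R mu setT measurableT
    (fun n => EFin \o u n) (EFin \o f) (EFin \o cst M).
- by move=> n; exact/measurable_EFinP.
- exact/measurable_EFinP.
- by apply: aeW => x _; apply: cvg_EFin; [exact: nearW|exact: uf].
- exact: iM.
- by apply: aeW => x n _ /=; rewrite lee_fin.
rewrite /Rintegral => uf_; apply: fine_cvg; rewrite fineK; first exact: uf_.
exact: integrable_fin_num (bounded_measurable_integrable mu bf).
Qed.

End Integration.

(** * A probability is determined by its integrals on an algebra of functions *)

Lemma subr_sqr_div01 {R : realFieldType} (a N : R) :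
  0 < N -> `|a| <= N -> 0 <= 1 - (a / N) ^+ 2 <= 1.
Proof.
move=> N0 aN; rewrite gerBl sqr_ge0 andbT subr_ge0 -real_normK ?num_real//.
by rewrite expr_le1// normrM normfV (gtr0_norm N0) ler_pdivrMr// mul1r.
Qed.

Definition function_algebra {X : Type} {R : realType} (A : set (X -> R)) : Prop :=
  [/\ forall c, A (cst c), forall f g, A f -> A g -> A (f \+ g)
    & forall f g, A f -> A g -> A (f \* g)].

Definition bounded_limits {X : Type} {R : realType} (A : set (X -> R)) :
    set (X -> R) :=
  [set h | exists u : nat -> X -> R, [/\ forall n, A (u n),
     exists M : R, forall n x, `|u n x| <= M
     & forall x, u n x @[n --> \oo] --> h x]].

Lemma function_algebra_horner {X : Type} {R : realType} (A : set (X -> R))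
    (f : X -> R) (q : {poly R}) :
  function_algebra A -> A f -> A (fun x => q.[f x]).
Proof.
move=> [Ac AD AM] Af; elim/poly_ind: q => [|q c IH].
  by under eq_fun do rewrite horner0; exact: (Ac 0).
under eq_fun do rewrite hornerMXaddC.
exact: (AD (fun x => q.[f x] * f x) (cst c) (AM _ f IH Af) (Ac c)).
Qed.

Lemma function_algebra_bounded_limits {X : Type} {R : realType} (A : set (X -> R)) :
  function_algebra A -> function_algebra (bounded_limits A).
Proof.
move=> [Ac AD AM]; split.
- move=> c; exists (fun=> cst c); split => //; first by exists `|c|.
  by move=> x; exact: cvg_cst.
- move=> f g [u [Au [M uM] uf]] [v [Av [N vN] vg]]; exists (fun n => u n \+ v n).
  split => [n||x]; [exact: AD| |by apply: cvgD; [exact: uf|exact: vg]].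
  by exists (M + N) => n x; rewrite (le_trans (ler_normD _ _))// lerD.
- move=> f g [u [Au [M uM] uf]] [v [Av [N vN] vg]]; exists (fun n => u n \* v n).
  split => [n||x]; [exact: AM| |by apply: cvgM; [exact: uf|exact: vg]].
  by exists (M * N) => n x; rewrite normrM ler_pM.
Qed.

(** If |f| <= N then |f| / N is the square root of 1 - v with v = 1 - (f / N)^2 in
[0, 1], hence the limit of the partial sums of the binomial series at v, which
are polynomials in f. *)
Lemma bounded_limits_norm {X : Type} {R : realType} (A : set (X -> R)) (f : X -> R)
    (M : R) :
  function_algebra A -> A f -> (forall x, `|f x| <= M) ->
  bounded_limits A (fun x => `|f x|).
Proof.
move=> hA Af fM.
pose N := Num.max M 1.
have N0 : 0 < N by rewrite lt_max ltr01 orbT.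
have fN x : `|f x| <= N by rewrite le_max fM.
pose v x := 1 - (f x / N) ^+ 2.
have v01 x : 0 <= v x <= 1 by exact: subr_sqr_div01.
have h01 : 0 < (2^-1 : R) <= 1 by rewrite invr_gt0 ltr0n invf_le1 ?ltr0n// ler1n.
have h01' : 0 <= (2^-1 : R) <= 1 by case/andP: h01 => /ltW -> ->.
exists (fun n x => N * (binom_poly 2^-1 n).[v x]); split => [n||x].
- have -> : (fun x => N * (binom_poly 2^-1 n).[v x]) =
            (fun x => (N *: (binom_poly 2^-1 n \Po (1 - N^-2 *: 'X^2))).[f x]).
    apply/funext => x; rewrite hornerZ horner_comp hornerD hornerN hornerZ hornerXn.
    by rewrite hornerC /v exprMn exprVn [_ ^+ 2 / _]mulrC.
  exact: (function_algebra_horner A f _ hA Af).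
- exists N => n x; have /andP[v0 v1] := v01 x.
  rewrite normrM gtr0_norm// ler_piMr ?(ltW N0)//.
  by rewrite ger0_norm ?binom_poly_ge0 ?binom_poly_le1.
- have -> : `|f x| = N * (1 - v x) `^ 2^-1.
    rewrite /v subKr powR12_sqrt ?sqr_ge0// sqrtr_sqr normrM normfV (gtr0_norm N0).
    by rewrite mulrCA divff ?mulr1// lt0r_neq0.
  by apply: cvgM; [exact: cvg_cst|exact: cvg_binom_poly].
Qed.

Lemma measurable_support {d} {X : measurableType d} {R : realType} (h : X -> R) :
  measurable_fun setT h -> measurable [set x | h x != 0].
Proof.
move=> mh; have -> : [set x | h x != 0] = h @^-1` [set~ 0].
  by apply/seteqP; split => x /= /eqP.
by rewrite -[_ @^-1` _]setTI; apply: mh => //; exact: measurableC.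
Qed.

Section Determination.
Context {d : measure_display} {X : measurableType d} {R : realType}.
Variables (mu nu : probability X R) (A : set (X -> R)).
Hypothesis algA : function_algebra A.
Hypothesis bndA : A `<=` bounded_measurable.
Hypothesis intA : forall f, A f -> \int[mu]_x f x = \int[nu]_x f x.

Let sub_bounded_limits : A `<=` bounded_limits A.
Proof.
move=> f Af; exists (fun=> f); split => // [|x]; last exact: cvg_cst.
by have [_ [M fM]] := bndA f Af; exists M.
Qed.

Let bounded_limits_bounded : bounded_limits A `<=` bounded_measurable.
Proof.
move=> h [u [Au [M uM] uh]]; split.
  by apply: measurable_fun_cvg => [n|x _]; [exact: (bndA _ (Au n)).1|exact: uh].
by exists M => x; exact: cvgr_norm_le (uh x) (uM^~ x).
Qed.

Let integral_bounded_limits h :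
  bounded_limits A h -> \int[mu]_x h x = \int[nu]_x h x.
Proof.
move=> [u [Au [M uM] uh]]; have mu_ n := (bndA _ (Au n)).1.
rewrite -(cvg_lim (@Rhausdorff R) (bounded_convergence mu u h M mu_ uM uh)).
rewrite -(cvg_lim (@Rhausdorff R) (bounded_convergence nu u h M mu_ uM uh)).
by congr (lim (_ @ \oo)); apply/funext => n; exact: intA.
Qed.

(** With v = 1 - (h / N)^2 in [0, 1], equal to 1 exactly where h vanishes, the
polynomials 1 - v ^+ n in h converge to the indicator of the support of h. *)
Let measure_support h :
  bounded_limits A h -> mu [set x | h x != 0] = nu [set x | h x != 0].
Proof.
move=> Ch; have [mh [M hM]] := bounded_limits_bounded h Ch.
pose N := Num.max M 1.
have N0 : 0 < N by rewrite lt_max ltr01 orbT.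
have hN x : `|h x| <= N by rewrite le_max hM.
pose v x := 1 - (h x / N) ^+ 2.
have v01 x : 0 <= v x <= 1 by exact: subr_sqr_div01.
pose u n x := 1 - v x ^+ n.
have uM n x : `|u n x| <= 1.
  have /andP[v0 v1] := v01 x.
  by rewrite /u ger0_norm ?subr_ge0 ?exprn_ile1// gerBl exprn_ge0.
have Cu n : bounded_limits A (u n).
  have -> : u n = (fun x => (1 - (1 - N^-2 *: 'X^2) ^+ n).[h x]).
    apply/funext => x; rewrite hornerD hornerN horner_exp hornerD hornerN hornerZ.
    by rewrite hornerXn hornerC /u /v exprMn exprVn [_ ^+ 2 / _]mulrC.
  exact: (function_algebra_horner _ h _ (function_algebra_bounded_limits A algA) Ch).
have mu_ n := (bounded_limits_bounded _ (Cu n)).1.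
pose D := [set x | h x != 0].
have mD : measurable D by exact: measurable_support.
have uD x : u n x @[n --> \oo] --> (\1_D x : R).
  rewrite indicE /u; have [/set_mem/= Dx|Dx] := boolP (x \in D).
    rewrite -[X in _ --> X]subr0; apply: cvgB; first exact: cvg_cst.
    apply: cvg_expr; have /andP[v0 _] := v01 x; rewrite ger0_norm// /v ltrBlDr ltrDl.
    by rewrite exprn_even_gt0//= mulf_neq0// invr_neq0// lt0r_neq0.
  have h0 : h x = 0 by apply/eqP; apply: contraNT Dx => ?; exact: mem_set.
  rewrite /v h0 mul0r expr0n subr0; under eq_fun do rewrite expr1n subrr.
  exact: cvg_cst.
have key (P : probability X R) : \int[P]_x u n x @[n --> \oo] --> fine (P D).
  have := bounded_convergence P u \1_D 1 mu_ uM uD.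
  by rewrite /Rintegral integral_indic// setIT.
have : fine (mu D) = fine (nu D).
  rewrite -(cvg_lim (@Rhausdorff R) (key mu)) -(cvg_lim (@Rhausdorff R) (key nu)).
  by congr (lim (_ @ \oo)); apply/funext => n; exact: integral_bounded_limits.
by move=> E; rewrite -[LHS]fineK ?fin_num_measure// -[RHS]fineK ?fin_num_measure// E.
Qed.

(** Supports of bounded limits form a pi-system because the support of a product
is the intersection of the supports. Moreover, f is positive exactly on the
support of f + |f|. *)
Lemma probability_eq_algebra :
  measurable `<=` <<s [set [set x | 0 < f x] | f in A] >> ->
  forall B, measurable B -> mu B = nu B.
Proof.
move=> genA.
have algC := function_algebra_bounded_limits A algA; have [Cc CD CM] := algC.
pose G := [set [set x | h x != 0] | h in bounded_limits A].
have mG : G `<=` measurable.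
  by move=> _ [h Ch <-]; exact/measurable_support/(bounded_limits_bounded h Ch).1.
have GT : G setT.
  exists (cst 1); first exact: Cc.
  by apply/seteqP; split => // x _ /=; exact: oner_neq0.
have GI : setI_closed G.
  move=> _ _ [h Ch <-] [k Ck <-]; exists (h \* k); first exact: CM.
  by apply/seteqP; split => x /=; rewrite mulf_eq0 negb_or => /andP.
have GA : [set [set x | 0 < f x] | f in A] `<=` G.
  move=> _ [f Af <-].
  exists (f \+ (fun x => `|f x|)).
    apply: CD; first exact: sub_bounded_limits.
    by have [_ [M fM]] := bndA f Af; exact: bounded_limits_norm fM.
  apply/seteqP; split => x /=; have [f0|f0] := leP (f x) 0.
  - by rewrite ler0_norm// subrr eqxx.
  - by [].
  - by [].
  - by rewrite gtr0_norm// lt0r_neq0// addr_gt0.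
move=> B mB; apply: (g_sigma_algebra_measure_unique G mG (fun=> setT)) => //.
- by rewrite bigcup_const.
- by move=> _ [h Ch <-]; exact: measure_support.
- by move=> _; exact: (le_lt_trans (probability_le1 mu measurableT) (ltry 1)).
- exact: sub_sigma_algebra2 GA _ (genA B mB).
Qed.

End Determination.

(** * Equal potentials force equal moments *)

Section Moments.
Context {d : measure_display} {X : measurableType d} {R : realType} {I : finType}.
Variables (mu nu : probability X R) (e : I -> X -> R) (s : R).
Hypothesis bnd_e : forall i, bounded_measurable (e i).

Let v z w := \sum_i e i z * e i w.

Hypothesis v01 : forall z w, 0 <= v z w <= 1.
Hypothesis s01 : 0 < s < 1.
Hypothesis eq_potential : forall z,
  \int[mu]_w ((1 - v z w) `^ s) = \int[nu]_w ((1 - v z w) `^ s).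

Let word {k : nat} (f : {ffun 'I_k -> I}) x := \prod_(j < k) e (f j) x.
(** Moments of the signed measure mu - nu. *)
Let m {k : nat} (f : {ffun 'I_k -> I}) := \int[mu]_x word f x - \int[nu]_x word f x.
Let approx n z w := (binom_poly s n).[v z w].
(** The potential at z of the signed measure mu - nu, with the kernel
(1 - v) `^ s replaced by a partial sum of its series. *)
Let gap n z := \int[mu]_w approx n z w - \int[nu]_w approx n z w.

Let bnd_word k (f : {ffun 'I_k -> I}) : bounded_measurable (word f).
Proof. exact: bounded_measurable_prod. Qed.

Let vXE k z w : v z w ^+ k = \sum_(f : {ffun 'I_k -> I}) word f z * word f w.
Proof.
rewrite -[in LHS](card_ord k) -prodr_const bigA_distr_bigA/=.
by apply: eq_bigr => f _; rewrite big_split.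
Qed.

Let bnd_vX k z : bounded_measurable (fun w => v z w ^+ k).
Proof.
rewrite (_ : (fun _ => _) = (fun w =>
    \sum_(f : {ffun 'I_k -> I}) word f z * word f w)); last first.
  by apply/funext => w; rewrite vXE.
apply: bounded_measurable_sum => f.
exact: bounded_measurableM (bounded_measurable_cst (word f z)) (bnd_word k f).
Qed.

Let integral_approx (Q : probability X R) n z : \int[Q]_w approx n z w =
  \sum_(k < n) binom_coef s k *
    \sum_(f : {ffun 'I_k -> I}) word f z * \int[Q]_w word f w.
Proof.
under eq_Rintegral do rewrite /approx /binom_poly horner_poly.
rewrite (Rintegral_lincomb Q (index_enum 'I_n) (fun k => binom_coef s k)
  (fun k w => v z w ^+ k))//.
apply: eq_bigr => k _; congr (_ * _).
under eq_Rintegral do rewrite vXE.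
exact: Rintegral_lincomb.
Qed.

Let gapE n z : gap n z =
  \sum_(k < n) binom_coef s k * \sum_(f : {ffun 'I_k -> I}) m f * word f z.
Proof.
rewrite /gap !integral_approx -sumrB; apply: eq_bigr => k _.
rewrite -mulrBr -sumrB; congr (_ * _); apply: eq_bigr => f _.
by rewrite -mulrBr mulrC.
Qed.

Let bnd_homogeneous k :
  bounded_measurable (fun z => \sum_(f : {ffun 'I_k -> I}) m f * word f z).
Proof.
apply: bounded_measurable_sum => f.
exact: bounded_measurableM (bounded_measurable_cst (m f)) (bnd_word k f).
Qed.

Let integral_gap (Q : probability X R) n : \int[Q]_z gap n z =
  \sum_(k < n) binom_coef s k *
    \sum_(f : {ffun 'I_k -> I}) m f * \int[Q]_z word f z.
Proof.
under eq_Rintegral do rewrite gapE.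
rewrite (Rintegral_lincomb Q (index_enum 'I_n) (fun k => binom_coef s k)
  (fun k z => \sum_(f : {ffun 'I_k -> I}) m f * word f z))//.
by apply: eq_bigr => k _; congr (_ * _); exact: Rintegral_lincomb.
Qed.

(** The double integral of the truncated kernel against the signed measure
mu - nu in both variables. *)
Let energyE n : \int[mu]_z gap n z - \int[nu]_z gap n z =
  \sum_(k < n) binom_coef s k * \sum_(f : {ffun 'I_k -> I}) m f ^+ 2.
Proof.
rewrite !integral_gap -sumrB; apply: eq_bigr => k _.
rewrite -mulrBr -sumrB; congr (_ * _); apply: eq_bigr => f _.
by rewrite -mulrBr expr2.
Qed.

Let s01W : 0 <= s <= 1.
Proof. by case/andP: s01 => /ltW -> /ltW ->. Qed.

Let approx01 n z w : 0 <= approx n z w <= 1.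
Proof.
have /andP[v0 v1] := v01 z w.
by rewrite /approx binom_poly_ge0 ?v0// binom_poly_le1.
Qed.

Let measurable_approx n z : measurable_fun setT (approx n z).
Proof.
have -> : approx n z = (fun w => \sum_(k < n) binom_coef s k * v z w ^+ k).
  by apply/funext => w; rewrite /approx /binom_poly horner_poly.
apply: (bounded_measurable_sum _ (fun (k : 'I_n) w => _ * _) _).1 => k.
exact: bounded_measurableM (bounded_measurable_cst _) (bnd_vX k z).
Qed.

Let integral_approx01 (Q : probability X R) n z : 0 <= \int[Q]_w approx n z w <= 1.
Proof.
rewrite Rintegral_ge0/=; last by move=> w _; case/andP: (approx01 n z w).
have b_approx : bounded_measurable (approx n z).
  split; first exact: measurable_approx.
  by exists 1 => w; have /andP[S0 S1] := approx01 n z w; rewrite ger0_norm.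
rewrite (@le_trans _ _ (\int[Q]_w cst (1 : R) w))//.
  apply: le_Rintegral => //.
  - exact: bounded_measurable_integrable.
  - exact/bounded_measurable_integrable/bounded_measurable_cst.
  - by move=> w _; case/andP: (approx01 n z w).
by rewrite Rintegral_cst//= probability_setT mul1r.
Qed.

Let cvg_gap z : gap n z @[n --> \oo] --> (0 : R).
Proof.
have cvg_approx (Q : probability X R) :
    \int[Q]_w approx n z w @[n --> \oo] --> \int[Q]_w ((1 - v z w) `^ s).
  apply: (bounded_convergence Q (approx^~ z) _ 1).
  - by move=> n; exact: measurable_approx.
  - by move=> n w; have /andP[S0 S1] := approx01 n z w; rewrite ger0_norm.
  - move=> w; apply: cvg_binom_poly => //.
    by case/andP: s01 => -> /ltW ->.
rewrite -(subrr (\int[mu]_w ((1 - v z w) `^ s))) {2}eq_potential.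
by apply: cvgB; exact: cvg_approx.
Qed.

Let cvg_energy : \int[mu]_z gap n z - \int[nu]_z gap n z @[n --> \oo] --> (0 : R).
Proof.
have cvg_int (Q : probability X R) : \int[Q]_z gap n z @[n --> \oo] --> (0 : R).
  have -> : (0 : R) = \int[Q]_x cst 0 x by rewrite Rintegral_cst// mul0r.
  apply: (bounded_convergence Q gap _ 1) => [n|n z|z]; last exact: cvg_gap.
  - rewrite (_ : gap n = (fun z => \sum_(k < n) binom_coef s k *
        \sum_(f : {ffun 'I_k -> I}) m f * word f z)); last first.
      by apply/funext => z; rewrite gapE.
    apply: (bounded_measurable_sum _ (fun (k : 'I_n) w => _ * _) _).1 => k.
    exact: bounded_measurableM (bounded_measurable_cst _) (bnd_homogeneous k).
  - have /andP[a0 a1] := integral_approx01 mu n z.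
    have /andP[b0 b1] := integral_approx01 nu n z.
    by rewrite ler_norml /gap; apply/andP; split; lra.
rewrite -[X in _ --> X](subrr (0 : R)).
by apply: cvgB; exact: cvg_int.
Qed.

(** The energies [energyE] tend to 0, since the potentials agree. Each of them is
a sum of nonpositive terms (the constant term of the series contributes 0 as both
measures have mass 1), so every single term vanishes. *)
Lemma eq_moments (r : seq I) :
  \int[mu]_x \prod_(i <- r) e i x = \int[nu]_x \prod_(i <- r) e i x.
Proof.
have m0 (f : {ffun 'I_0 -> I}) : m f = 0.
  rewrite /m /word; under eq_Rintegral do rewrite big_ord0.
  under [X in _ - X]eq_Rintegral do rewrite big_ord0.
  by rewrite !Rintegral_cst//= !probability_setT subrr.
have term_le0 k : binom_coef s k * \sum_(f : {ffun 'I_k -> I}) m f ^+ 2 <= 0.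
  case: k => [|k]; first by rewrite big1 ?mulr0// => f _; rewrite m0 expr0n.
  by rewrite mulr_le0_ge0 ?binom_coef_le0// sumr_ge0// => f _; exact: sqr_ge0.
have mS k (f : {ffun 'I_k.+1 -> I}) : m f = 0.
  have ak := binom_coef_lt0 s k s01.
  suff : 0 <= binom_coef s k.+1 * m f ^+ 2.
    by rewrite nmulr_rge0// => h; apply/eqP; rewrite -sqrf_eq0 eq_le h sqr_ge0.
  rewrite -(cvg_lim (@Rhausdorff R) cvg_energy); apply: limr_le.
    by apply/cvg_ex; eexists; exact: cvg_energy.
  near=> n; have kn : (k.+1 < n)%N by near: n; exact: nbhs_infty_gt.
  rewrite energyE (bigD1 (Ordinal kn))//= -[leRHS]addr0 lerD//; last first.
    by apply: sumr_le0 => j _; exact: term_le0.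
  rewrite ler_wnM2l ?(ltW ak)// (bigD1 f)//= lerDl sumr_ge0// => g _.
  exact: sqr_ge0.
pose f := [ffun j : 'I_(size r) => tnth (in_tuple r) j].
have mf : m f = 0 by move: (size r) f => [|k] f; [exact: m0|exact: mS].
have wE x : \prod_(i <- r) e i x = word f x.
  by rewrite big_tnth; apply: eq_bigr => j _; rewrite ffunE.
under eq_Rintegral do rewrite wE; under [RHS]eq_Rintegral do rewrite wE.
by apply/eqP; rewrite -subr_eq0; apply/eqP.
Unshelve. all: by end_near. Qed.

End Moments.

(** * Kernels with finitely many features *)

Definition monomial_span {X I : Type} {R : realType} (e : I -> X -> R) : set (X -> R) :=
  [set f | exists t : seq (R * seq I),
     f = fun x => \sum_(q <- t) q.1 * \prod_(i <- q.2) e i x].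

Lemma function_algebra_span {X I : Type} {R : realType} (e : I -> X -> R) :
  function_algebra (monomial_span e).
Proof.
split.
- move=> c; exists [:: (c, [::])]; apply/funext => x.
  by rewrite big_seq1 big_nil mulr1.
- move=> _ _ [t ->] [u ->]; exists (t ++ u); apply/funext => x.
  by rewrite big_cat.
- move=> _ _ [t ->] [u ->].
  exists [seq (q.1 * r.1, q.2 ++ r.2) | q <- t, r <- u]; apply/funext => x.
  rewrite /= big_allpairs_dep mulr_suml; apply: eq_bigr => q _.
  rewrite mulr_sumr; apply: eq_bigr => r _.
  by rewrite big_cat/= mulrACA.
Qed.

Lemma monomial_span_gen {X I : Type} {R : realType} (e : I -> X -> R) (i : I) :
  monomial_span e (e i).
Proof.
by exists [:: (1, [:: i])]; apply/funext => x; rewrite !big_seq1 mul1r.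
Qed.

Section SpanMeasurable.
Context {d : measure_display} {X : measurableType d} {R : realType} {I : Type}.
Variable e : I -> X -> R.
Hypothesis bnd_e : forall i, bounded_measurable (e i).

Lemma monomial_span_bounded : monomial_span e `<=` bounded_measurable.
Proof.
move=> _ [t ->]; apply: bounded_measurable_sum => q.
apply: bounded_measurableM (bounded_measurable_cst q.1) _.
exact: bounded_measurable_prod.
Qed.

Lemma eq_integral_span (mu nu : probability X R) :
  (forall r : seq I,
    \int[mu]_x \prod_(i <- r) e i x = \int[nu]_x \prod_(i <- r) e i x) ->
  forall f, monomial_span e f -> \int[mu]_x f x = \int[nu]_x f x.
Proof.
move=> eq_mom _ [t ->].
have bprod q : bounded_measurable (fun x => \prod_(i <- q.2) e i x).
  exact: bounded_measurable_prod.
rewrite !(Rintegral_lincomb _ t (fun q => q.1) (fun q x => \prod_(i <- q.2) e i x))//.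
by apply: eq_bigr => q _; rewrite eq_mom.
Qed.

End SpanMeasurable.

(** The abstract form of the theorem: the points enter only through the features
e_i, and the last hypothesis says that these generate the sigma-algebra. *)
Lemma probability_eq_potential {d : measure_display} {X : measurableType d}
    {R : realType} {I : finType} (mu nu : probability X R) (e : I -> X -> R) (s : R) :
  (forall i, bounded_measurable (e i)) ->
  (forall z w, 0 <= \sum_i e i z * e i w <= 1) ->
  0 < s < 1 ->
  (forall z, \int[mu]_w ((1 - \sum_i e i z * e i w) `^ s) =
             \int[nu]_w ((1 - \sum_i e i z * e i w) `^ s)) ->
  measurable `<=` <<s [set [set x | 0 < f x] | f in monomial_span e] >> ->
  forall B, measurable B -> mu B = nu B.
Proof.
move=> bnd_e v01 s01 eq_pot; apply: probability_eq_algebra.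
- exact: function_algebra_span.
- exact: monomial_span_bounded.
- by apply: eq_integral_span => // r; exact: (eq_moments mu nu e s).
Qed.

(** * The circle: coordinates, topology and Borel sets *)

Definition circle_re {R : realType} (z : circle R) : R :=
  complex.Re (set_val z : R[i]).

Definition circle_im {R : realType} (z : circle R) : R :=
  complex.Im (set_val z : R[i]).

Lemma circle_re_im {R : realType} (z : circle R) :
  circle_re z ^+ 2 + circle_im z ^+ 2 = 1.
Proof.
rewrite /circle_re /circle_im; have : unit_circle R (set_val z) by exact: set_valP.
case: (set_val z) => a b /= ab1; rewrite -[RHS](expr1n R 2) -ab1 sqr_sqrtr//.
by rewrite addr_ge0 ?sqr_ge0.
Qed.

Lemma chord_distE {R : realType} (z w : circle R) : chord_dist z w =
  Num.sqrt (1 - (1 + circle_re z * circle_re w + circle_im z * circle_im w) / 2).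
Proof.
have := circle_re_im z; have := circle_re_im w.
rewrite /chord_dist /circle_re /circle_im.
case: (set_val z) (set_val w) => a b [a' b'] /= ab ab'.
congr Num.sqrt.
rewrite !addr0 !mul0r oppr0 !mul0r expr0n !addr0 subr0.
transitivity (((a - a') ^+ 2 + (b - b') ^+ 2) / 4); first by field.
lra.
Qed.

Lemma complex_dist_lt {R : realType} (z w : R[i]) (r : R) : 0 < r ->
  (`|z - w| < r%:C%C) =
  ((complex.Re z - complex.Re w) ^+ 2 + (complex.Im z - complex.Im w) ^+ 2 < r ^+ 2).
Proof.
move=> r0; case: z w => a b [a' b'].
rewrite normc_def ltcR /= -[X in _ < X]gtr0_norm// -sqrtr_sqr ltr_sqrt//.
by rewrite exprn_gt0.
Qed.

(** The norm on the complex numbers, hence the radius of a ball, takes values in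
the complex numbers themselves; a positive radius is a real number. *)
Lemma complex_nbhsP {R : realType} (z : R[i]^o) (A : set R[i]^o) :
  nbhs z A <-> exists2 r : R, 0 < r &
    forall w : R[i]^o, (complex.Re (z : R[i]) - complex.Re (w : R[i])) ^+ 2
      + (complex.Im (z : R[i]) - complex.Im (w : R[i])) ^+ 2 < r ^+ 2 -> A w.
Proof.
rewrite nbhs_ballP; split=> [[r /= r0 zA]|[r r0 zA]].
  have [r0' rE] : 0 < complex.Re r /\ r = (complex.Re r)%:C%C.
    move: r0; rewrite ltcE => /andP[/eqP/= i0 ->]; split => //.
    by rewrite [LHS]complexE i0 mulr0 addr0.
  exists (complex.Re r) => // w h; apply: zA.
  by rewrite /ball/= /ball_/= rE complex_dist_lt.
exists r%:C%C => /=; first by rewrite ltcR.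
by move=> w; rewrite /ball/= /ball_/= complex_dist_lt//; exact: zA.
Qed.

Lemma continuous_complex_Re {R : realType} : continuous (@complex.Re R : R[i]^o -> R).
Proof.
move=> z A /nbhs_ballP[r /= r0 rA]; apply/complex_nbhsP.
exists r => // w h; apply: rA; rewrite /ball/= -(ltr_pXn2r (ltn0Sn 1)) ?nnegrE ?(ltW r0)//.
by rewrite real_normK ?num_real//; apply: le_lt_trans h; rewrite lerDl sqr_ge0.
Qed.

Lemma continuous_complex_Im {R : realType} : continuous (@complex.Im R : R[i]^o -> R).
Proof.
move=> z A /nbhs_ballP[r /= r0 rA]; apply/complex_nbhsP.
exists r => // w h; apply: rA; rewrite /ball/= -(ltr_pXn2r (ltn0Sn 1)) ?nnegrE ?(ltW r0)//.
by rewrite real_normK ?num_real//; apply: le_lt_trans h; rewrite lerDr sqr_ge0.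
Qed.

Lemma measurable_circle {R : realType} (f : R[i]^o -> R) :
  continuous f ->
  measurable_fun [set: borel_circle R] (fun z : circle R => f (set_val z)).
Proof.
move=> /continuousP cf; apply: (measurability _ (RGenOpens.measurableE R)).
move=> _ [_ [a [b ->] <-]]; rewrite setTI; apply: sub_sigma_algebra.
by exists (f @^-1` `]a, b[%classic) => //; exact/cf/interval_open.
Qed.

Lemma circle_bounded {R : realType} (f : R[i]^o -> R) : continuous f ->
  (forall z : circle R, `|f (set_val z)| <= 1) ->
  bounded_measurable (fun z : borel_circle R => f (set_val (z : circle R))).
Proof. by move=> cf f1; split; [exact: measurable_circle|exists 1]. Qed.

(** The centers have rational coordinates in the plane and need not lie on the
circle. *)
Definition rational_disc {R : realType} (q : rat * rat * rat) : set (circle R) :=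
  [set z | (circle_re z - ratr q.1.1) ^+ 2 + (circle_im z - ratr q.1.2) ^+ 2
           < ratr q.2 ^+ 2].

Lemma open_circle_cover {R : realType} (U : set (circle R)) : open U ->
  U = \bigcup_(q in [set q | rational_disc q `<=` U]) rational_disc q.
Proof.
move=> [V oV <-]; apply/seteqP; split => [z Vz|z [q /= qV /qV]//].
have /complex_nbhsP[r r0 rV] : nbhs (set_val z) V by exact: open_nbhs_nbhs.
(* a rational radius c < r / 2, and a center within c / 2 of z in each coordinate *)
have r2 : r / 4 < r / 2 by lra.
have [c] := rat_in_itvoo r2; rewrite in_itv/= => /andP[c0 c1].
have c00 : 0 < ratr c :> R by lra.
have near (x : R) : exists a : rat, (x - ratr a) ^+ 2 < ratr c ^+ 2 / 4.
  have h : x - ratr c / 2 < x + ratr c / 2 by lra.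
  have [a] := rat_in_itvoo h; rewrite in_itv/= => /andP[a0 a1].
  exists a; nra.
have [a za] := near (circle_re z); have [b zb] := near (circle_im z).
exists (a, b, c); rewrite /rational_disc /=; last by nra.
move=> w /= wd; apply: rV; rewrite -/(circle_re z) -/(circle_re w).
rewrite -/(circle_im z) -/(circle_im w).
have r1 : ratr c ^+ 2 < r ^+ 2 / 4 by nra.
move: (circle_re z) (circle_re w) (circle_im z) (circle_im w) za zb wd => x x' y y'.
move: (ratr a) (ratr b) (ratr c ^+ 2) r1 => A B C ? ? ? ?.
(* 2 |z - q|^2 + 2 |w - q|^2 - |z - w|^2 = |z + w - 2 q|^2 *)
have := sqr_ge0 r; have := sqr_ge0 (x + x' - 2 * A); have := sqr_ge0 (y + y' - 2 * B); lra.
Qed.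

(** The factor sqrt (1/2) makes the kernel [circle_feature_sum] take values in
[0, 1], where the binomial series converges. *)
Definition circle_feature {R : realType} (i : option bool) (z : circle R) : R :=
  Num.sqrt 2^-1 *
    match i with None => 1 | Some false => circle_re z | Some true => circle_im z end.

Lemma circle_feature_sum {R : realType} (z w : circle R) :
  \sum_i circle_feature i z * circle_feature i w =
  (1 + circle_re z * circle_re w + circle_im z * circle_im w) / 2.
Proof.
have h : Num.sqrt (2^-1 : R) * Num.sqrt 2^-1 = 2^-1.
  by rewrite -expr2 sqr_sqrtr// invr_ge0.
rewrite (bigD1 None)//= (bigD1 (Some false))//= (bigD1 (Some true))//= big1.
  rewrite /circle_feature !(mulrACA _ _ (Num.sqrt 2^-1)) h addr0 mulr1; ring.
by case => [[]|].
Qed.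

Lemma circle_feature_bounded {R : realType} (i : option bool) :
  bounded_measurable (circle_feature i : borel_circle R -> R).
Proof.
apply: bounded_measurableM (bounded_measurable_cst _) _.
case: i => [[]|]; last exact: bounded_measurable_cst.
- apply: (circle_bounded _ continuous_complex_Im) => z; rewrite -/(circle_im z).
  by have := circle_re_im z; rewrite ler_norml => h; apply/andP; split; nra.
- apply: (circle_bounded _ continuous_complex_Re) => z; rewrite -/(circle_re z).
  by have := circle_re_im z; rewrite ler_norml => h; apply/andP; split; nra.
Qed.

Lemma circle_kernel01 {R : realType} (z w : circle R) :
  0 <= \sum_i circle_feature i z * circle_feature i w <= 1.
Proof.
rewrite circle_feature_sum; have := circle_re_im z; have := circle_re_im w.
move: (circle_re z) (circle_re w) (circle_im z) (circle_im w) => x x' y y' h h'.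
have := sqr_ge0 (x - x'); have := sqr_ge0 (y - y').
have := sqr_ge0 (x + x'); have := sqr_ge0 (y + y').
by move=> *; apply/andP; split; lra.
Qed.

Lemma chord_dist_powR {R : realType} (p : R) (z w : circle R) :
  chord_dist z w `^ p =
  (1 - \sum_i circle_feature i z * circle_feature i w) `^ (p / 2).
Proof.
have /andP[_ v1] := circle_kernel01 z w.
rewrite chord_distE -circle_feature_sum -powR12_sqrt ?subr_ge0//.
by rewrite -powRrM mulrC.
Qed.

(** A disc is given by a polynomial inequality in the coordinates. *)
Lemma circle_disc_span {R : realType} (q : rat * rat * rat) :
  exists2 f : borel_circle R -> R, monomial_span circle_feature f &
    rational_disc q = [set z | 0 < f z].
Proof.
have [Sc SD SM] := function_algebra_span (@circle_feature R).
have s0 : Num.sqrt (2^-1 : R) != 0 by rewrite sqrtr_eq0 -ltNge invr_gt0.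
have coordS (b : bool) : monomial_span circle_feature
    (fun z : circle R => if b then circle_im z else circle_re z).
  rewrite (_ : (fun _ => _) = cst (Num.sqrt 2^-1)^-1 \* circle_feature (Some b)).
    by apply: SM; [exact: Sc|exact: monomial_span_gen].
  by apply/funext => z; rewrite /circle_feature /= mulKf//; case: b.
have sqS (b : bool) (c : R) : monomial_span circle_feature
    (fun z : circle R => ((if b then circle_im z else circle_re z) - c) ^+ 2).
  have S1 := SD _ _ (coordS b) (Sc (- c)).
  by have := SM _ _ S1 S1; congr monomial_span; apply/funext => z; rewrite expr2.
pose g (z : circle R) := (circle_re z - ratr q.1.1) ^+ 2 + (circle_im z - ratr q.1.2) ^+ 2.
have Sg : monomial_span circle_feature g by exact: SD (sqS false _) (sqS true _).
exists (cst (ratr q.2 ^+ 2) \+ (cst (-1) \* g)).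
  by apply: SD; [exact: Sc|apply: SM; [exact: Sc|exact: Sg]].
by apply/seteqP; split => z /=; rewrite mulN1r subr_gt0.
Qed.

Lemma borel_circle_gen {R : realType} :
  @measurable _ (borel_circle R) `<=`
  <<s [set [set z | 0 < f z] | f in monomial_span circle_feature] >>.
Proof.
apply: smallest_sub; first exact: smallest_sigma_algebra.
move=> U /open_circle_cover ->; set G := (G in <<s G >>).
rewrite bigcup_mkcond.
suff mF q : (<<s G >>) (if q \in [set q | rational_disc q `<=` U]
    then rational_disc q else set0).
  exact: (@countable_bigcupT_measurable G.-sigma (g_sigma_algebraType G) _ _
    (countableP _) mF).
case: ifP => _; last exact: (@measurable0 _ (g_sigma_algebraType G)).
have [f Sf ->] := @circle_disc_span R q.
by apply: sub_gen_smallest; exists f.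
Qed.

(* The library leaves the values of a measure on non-measurable sets
   unspecified, so equality of measures is equality on all Borel sets. *)
Theorem mainTheorem3 (R : realType) (p : R) (hp : 1 <= p < 2)
    (mu nu : probability (borel_circle R) R)
    (hpot : forall z : circle R,
        wasserstein_potential p mu z = wasserstein_potential p nu z) :
  forall A : set (borel_circle R), measurable A -> mu A = nu A.
Proof.
have /andP[p1 p2] := hp.
apply: (probability_eq_potential mu nu circle_feature (p / 2)).
- exact: circle_feature_bounded.
- exact: circle_kernel01.
- by apply/andP; split; lra.
- move=> z; have := hpot z; rewrite /wasserstein_potential.
  under eq_Rintegral do rewrite chord_dist_powR.
  by under [in X in _ = X]eq_Rintegral do rewrite chord_dist_powR.
- exact: borel_circle_gen.
Qed.
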